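(* Let $\mathcal{E}$ be an indecomposable, five-dimensional, nilpotent evolution algebra over an algebraically closed field $\mathbb{F}$ of characteristic not two. Then: (i) The dimension of $\mathrm{ann}(\mathcal{E})$ is $1$ or $2$. (ii) If the dimension of $\mathrm{ann}(\mathcal{E})$ is $2$, then $\mathcal{E}$ is isomorphic to one and only one of the following evolution algebras, each given by the squares of the elements of a natural basis $\{e_1,\ldots,e_5\}$ (products $e_je_k$ with $j\ne k$ are $0$, and squares not listed are $0$): - (type $[2,3]$) $e_1^2=e_4$, $e_2^2=e_4+e_5$, $e_3^2=e_5$; - (type $[2,2,1]$) $e_1^2=e_2+e_3$, $e_2^2=e_4$, $e_3^2=e_5$; - (type $[2,1,2]$) $e_1^2=e_3$, $e_2^2=e_3+e_5$, $e_3^2=e_4$.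
   Context: An evolution algebra (finite-dimensional here) is an algebra $\mathcal{E}$ over $\mathbb{F}$ with a basis $\{e_1,\ldots,e_n\}$ (a natural basis) such that $e_je_k=0$ for $j\neq k$; it is automatically commutative, and need not be associative. An algebra is decomposable if it is the direct sum of two nonzero ideals, and indecomposable otherwise. For an algebra $\mathcal{A}$, $\mathrm{ann}(\mathcal{A})=\{x\in\mathcal{A}: x\mathcal{A}=\mathcal{A}x=0\}$, $\mathrm{ann}^0(\mathcal{A})=0$, and $\mathrm{ann}^j(\mathcal{A})$ is defined by $\mathrm{ann}^j(\mathcal{A})/\mathrm{ann}^{j-1}(\mathcal{A})=\mathrm{ann}(\mathcal{A}/\mathrm{ann}^{j-1}(\mathcal{A}))$. With $\mathcal{A}^1=\mathcal{A}$ and $\mathcal{A}^{k+1}=\sum_{j=1}^k\mathcal{A}^j\mathcal{A}^{k+1-j}$, $\mathcal{A}$ is nilpotent if $\mathcal{A}^m=0$ for some $m$, equivalently $\mathrm{ann}^r(\mathcal{A})=\mathcal{A}$ for some $r$. The type of a finite-dimensional nilpotent algebra $\mathcal{A}$ is the sequence $[n_1,\ldots,n_r]$, where $r$ is the least natural number with $\mathrm{ann}^r(\mathcal{A})=\mathcal{A}$ and $n_j=\dim\mathrm{ann}^j(\mathcal{A})-\dim\mathrm{ann}^{j-1}(\mathcal{A})$. *)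

(* Defs.v *)
From HB Require Import structures.
From mathcomp Require Import all_boot all_order all_algebra.

Set Implicit Arguments.
Unset Strict Implicit.
Unset Printing Implicit Defensive.

Import GRing.Theory.
Local Open Scope ring_scope.

(* A finite-dimensional algebra over F, not necessarily associative or        *)
(* unital, is a vectType F together with a bilinear product.                  *)

Section Algebra.

Variables (F : fieldType) (E : vectType F) (mul : {bilinear E -> E -> E}).
Implicit Types (U V I J W : {vspace E}) (x y : E).

Definition is_natural_basis n (e : n.-tuple E) : Prop :=
  basis_of {:E} e /\
  forall j k : 'I_n, j != k -> mul (tnth e j) (tnth e k) = 0.

Definition is_evolution_algebra : Prop :=
  exists n (e : n.-tuple E), is_natural_basis e.

Definition is_ideal I : Prop :=
  forall x y, x \in I -> mul x y \in I /\ mul y x \in I.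

Definition decomposable : Prop :=
  exists I J : {vspace E},
    [/\ is_ideal I /\ I != 0%VS, is_ideal J /\ J != 0%VS,
        (I + J)%VS = fullv & (I :&: J)%VS = 0%VS].

Definition indecomposable : Prop := ~ decomposable.

(* The subspace {x | x E + E x is contained in W}; see mem_transporter.       *)
Definition transporter W : {vspace E} :=
  (\bigcap_(b <- vbasis {:E})
     (linfun (applyr mul b) @^-1: W :&: linfun (mul b) @^-1: W))%VS.

Definition ann : {vspace E} := transporter 0%VS.

(* A class x + ann^j annihilates E / ann^j exactly when x E + E x is          *)
(* contained in ann^j; upper_ann_quotient below is the definition by          *)
(* annihilators of quotient algebras.                                         *)
Fixpoint upper_ann (j : nat) : {vspace E} :=
  if j is j'.+1 then transporter (upper_ann j') else 0%VS.

(* The span of the products u v, with u in U and v in V; see mulvP.           *)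
Definition mulv U V : {vspace E} :=
  <<[seq mul u v | u <- vbasis U, v <- vbasis V]>>%VS.

(* powers k = [:: E^1; ...; E^k].                                             *)
Fixpoint powers (k : nat) : seq {vspace E} :=
  if k is k'.+1 then
    let s := powers k' in
    rcons s (if k' is 0 then fullv else
             \sum_(j < k') mulv (nth 0 s j) (nth 0 s (k' - j.+1)))%VS
  else [::].

(* E^k, meaningful for k > 0; see powerv1 and powervS.                        *)
Definition powerv (k : nat) : {vspace E} := nth 0%VS (powers k) k.-1.

Definition nilpotent : Prop := exists2 m, (0 < m)%N & powerv m = 0%VS.

Definition has_type (s : seq nat) : Prop :=
  [/\ upper_ann (size s) = fullv,
      forall r, upper_ann r = fullv -> (size s <= r)%N &
      forall j, (j < size s)%N ->
        nth 0%N s j = (\dim (upper_ann j.+1) - \dim (upper_ann j))%N].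

Lemma mem_transporter W x :
  reflect (forall y, mul x y \in W /\ mul y x \in W) (x \in transporter W).
Proof.
have memb (s : seq E) : (x \in (\bigcap_(b <- s)
    (linfun (applyr mul b) @^-1: W :&: linfun (mul b) @^-1: W))%VS)
    = all (fun b => (mul x b \in W) && (mul b x \in W)) s.
  elim: s => [|b s IH]; first by rewrite big_nil memvf.
  by rewrite big_cons !memv_cap IH -!memv_preim !lfunE.
rewrite /transporter memb.
apply: (iffP allP) => [h y | h b _]; last by apply/andP; have [] := h b.
rewrite (coord_vbasis (memvf y)) linear_sumr linear_sumlz /=.
by split; apply: memv_suml => i _ /=;
  have /andP[Wl Wr] := h _ (memt_nth 0 _ (ltn_ord i));
  rewrite ?linearZr_LR ?linearZl_LR memvZ.
Qed.

Lemma annP x : reflect (forall y, mul x y = 0 /\ mul y x = 0) (x \in ann).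
Proof.
apply: (iffP (mem_transporter 0 x)) => h y; have [] := h y.
  by rewrite !memv0 => /eqP-> /eqP->.
by move=> -> ->; rewrite mem0v.
Qed.

Lemma mulvP U V W :
  reflect (forall u v, u \in U -> v \in V -> mul u v \in W)
          (mulv U V <= W)%VS.
Proof.
apply: (iffP span_subvP) => [h u v Uu Vv | h _ /allpairsP[[u v] /= [Uu Vv ->]]].
  rewrite (coord_vbasis Uu) linear_sumlz memv_suml // => i _ /=.
  rewrite linearZl_LR memvZ // (coord_vbasis Vv) linear_sumr memv_suml // => j _.
  by rewrite linearZr_LR memvZ // h // allpairs_f ?memt_nth.
by rewrite h ?vbasis_mem.
Qed.

Lemma size_powers k : size (powers k) = k.
Proof. by elim: k => //= k IH; rewrite size_rcons IH. Qed.

Lemma nth_powers k i : (i < k)%N -> nth 0%VS (powers k) i = powerv i.+1.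
Proof.
elim: k => // k IH; rewrite ltnS leq_eqVlt => /predU1P[-> // | lt_ik].
by rewrite [powers _]/= nth_rcons size_powers lt_ik IH.
Qed.

Lemma powerv1 : powerv 1 = fullv.
Proof. by []. Qed.

Lemma powervS k : (0 < k)%N ->
  powerv k.+1 = (\sum_(1 <= j < k.+1) mulv (powerv j) (powerv (k.+1 - j)))%VS.
Proof.
case: k => // k _; rewrite {1}/powerv [powers _]/= -/(powers k.+1).
rewrite nth_rcons size_powers ltnn eqxx big_add1 big_mkord.
apply: eq_bigr => j _; have le_jk : (j <= k)%N by rewrite -ltnS.
by rewrite !nth_powers ?subSS ?ltnS ?leq_subr // (subSn le_jk).
Qed.

End Algebra.

Section Isomorphism.

Variables (F : fieldType) (E E' : vectType F).
Variables (mul : {bilinear E -> E -> E}) (mul' : {bilinear E' -> E' -> E'}).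

Definition alg_isomorphic : Prop :=
  exists f : {linear E -> E'},
    bijective f /\ {morph f : x y / mul x y >-> mul' x y}.

(* If p is a surjective homomorphism with kernel ann^j(E), i.e. a projection  *)
(* onto E / ann^j(E), then ann^(j+1)(E) is the preimage of ann(E / ann^j(E)). *)
Lemma upper_ann_quotient (j : nat) (p : {linear E -> E'}) :
    (forall y', exists y, p y = y') ->
    {morph p : x y / mul x y >-> mul' x y} ->
    (forall x, (p x == 0) = (x \in upper_ann mul j)) ->
  forall x, (x \in upper_ann mul j.+1) = (p x \in ann mul').
Proof.
move=> surj_p pM kerp x.
apply/mem_transporter/annP => h y; last first.
  by rewrite -!kerp !pM; have [-> ->] := h (p y); rewrite eqxx.
have [z <-] := surj_p y; rewrite -!pM.
by have [] := h z; rewrite -!kerp => /eqP-> /eqP->.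
Qed.

End Isomorphism.

(* The evolution algebra on F^n in which the canonical basis is natural and   *)
(* the square of its i-th element is the i-th row of M.                       *)
Section StructureMatrix.

Variables (F : fieldType) (n : nat) (M : 'M[F]_n).

Definition evo_mul (x y : 'rV[F]_n) : 'rV[F]_n := map2_mx *%R x y *m M.

Lemma evo_mul_is_bilinear :
  bilinear_for (GRing.Scale.Law.clone _ _ *:%R _)
               (GRing.Scale.Law.clone _ _ *:%R _) evo_mul.
Proof.
split=> u a x y /=; rewrite /evo_mul scalemxAl -mulmxDl; congr (_ *m M);
  apply/rowP => i; rewrite !mxE.
  by rewrite mulrDl mulrA.
by rewrite mulrDr mulrCA.
Qed.

HB.instance Definition _ :=
  bilinear_isBilinear.Build F 'rV[F]_n 'rV[F]_n 'rV[F]_n _ _ evo_mul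
    evo_mul_is_bilinear.

Lemma evo_mul_delta i j :
  evo_mul (delta_mx 0 i) (delta_mx 0 j) = if i == j then row i M else 0.
Proof.
rewrite /evo_mul; have [<- | ne_ij] := eqVneq i j.
  rewrite rowE; congr (_ *m M); apply/rowP=> k; rewrite !mxE eqxx /=.
  by case: (k == i); rewrite ?mulr1 ?mulr0.
rewrite (_ : map2_mx _ _ _ = 0) ?mul0mx //; apply/rowP=> k; rewrite !mxE /=.
by have [-> | _] := eqVneq k i; rewrite ?mul0r // (negPf ne_ij) mulr0.
Qed.

End StructureMatrix.

Section Models.

Variable F : fieldType.

(* The basis vector e_k of F^5, for 1 <= k <= 5.                              *)
Definition e5 (k : nat) : 'rV[F]_5 := delta_mx 0 (inord k.-1).

(* s lists e_1^2, ..., e_5^2.                                                 *)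
Definition squares5 (s : 5.-tuple 'rV[F]_5) : 'M[F]_5 :=
  \matrix_(i < 5) tnth s i.

Definition M23 : 'M[F]_5 :=
  squares5 [tuple e5 4; e5 4 + e5 5; e5 5; 0; 0].

Definition M221 : 'M[F]_5 :=
  squares5 [tuple e5 2 + e5 3; e5 4; e5 5; 0; 0].

Definition M212 : 'M[F]_5 :=
  squares5 [tuple e5 3; e5 3 + e5 5; e5 4; 0; 0].

Definition model (i : 'I_3) : 'M[F]_5 := tnth [tuple M23; M221; M212] i.

End Models.

(* Main.v *)
Require Import Defs.
From HB Require Import structures.
From mathcomp Require Import all_boot all_order all_algebra.

Set Implicit Arguments.
Unset Strict Implicit.
Unset Printing Implicit Defensive.

Import GRing.Theory.
Local Open Scope ring_scope.

(* An indecomposable E satisfies ann(E) <= E^2, since a vector of ann(E)       *)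
(* outside E^2 spans an ideal with a complementary ideal containing E^2. As    *)
(* E^2 is spanned by the 5 - dim ann(E) nonzero squares, dim ann(E) <= 2.      *)
(* If dim ann(E) = 2, let a, b, c be the natural basis vectors outside ann(E). *)
(* Then E^2 has dimension at most 3 and contains ann(E), so that modulo ann(E) *)
(* the squares of a, b, c are multiples p q, p' q, p'' q of a single vector q, *)
(* and nilpotency forces (p, p', p'') and q to have disjoint supports. Empty   *)
(* support gives type [2,3]; supports of sizes 1 and 2 give [2,2,1], of sizes  *)
(* 2 and 1 give [2,1,2], and of sizes 1 and 1 make E decomposable. The scalars *)
(* are normalised with square roots. The types are isomorphism invariants; in  *)
(* fact dim ann^2 already separates the three models.                          *)

(** Positivity of dim ann(E) comes from the last nonzero power ([nilpotent_ann_neq0]), and the bound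
    2 from [indecomposable_ann_sub_sqr] together with a count of the nonzero squares.

    For dim ann(E) = 2 the classification works with a [frame]: three orthogonal vectors independent
    modulo ann(E), whose squares span a space containing ann(E). [frame_sqr_mod_ann] puts the three
    squares on one line modulo ann(E), [frame_sqr_diag] turns nilpotency into the vanishing of the
    diagonal coefficients, and [classified_frame] sorts the resulting zero patterns by how many
    squares may leave ann(E): [classified_sqr_ann], [classified_one_sqr], [classified_two_sqr]. In
    each pattern, five vectors built from the frame either have the multiplication table of a model,
    so that [alg_isomorphic_evo_mul] applies, or fall into two lists spanning complementary ideals,
    which [decomposable_cat] excludes.

    Uniqueness holds because isomorphisms preserve dim ann^k ([dim_upper_ann_iso]), and dim ann^2 is
    5, 4, 3 for the three models. These dimensions are computed on the 0/1 structure matrices. *)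

Lemma dim_upper_ann_iso (F : fieldType) (E E' : vectType F)
    (mul : {bilinear E -> E -> E}) (mul' : {bilinear E' -> E' -> E'}) k :
  alg_isomorphic mul mul' ->
  \dim (upper_ann mul k) = \dim (upper_ann mul' k).
Proof.
case=> f [[g fK gK] fM].
have mem_f j x : (x \in upper_ann mul j) = (f x \in upper_ann mul' j).
  elim: j x => [|j IH] x; first by rewrite !memv0 raddf_eq0 //; exact: can_inj fK.
  apply/mem_transporter/mem_transporter => h y; last first.
    by rewrite !IH !fM; exact: h.
  by rewrite -[y]gK -!fM -!IH; exact: h.
rewrite -(@limg_dim_eq _ _ _ (linfun f)); last first.
  apply/eqP; rewrite -subv0 (subv_trans (capvSr _ _)) // subv0.
  by apply/lker0P => x y; rewrite !lfunE; apply: (can_inj fK).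
congr (\dim _); apply/vspaceP => y; rewrite -[y]gK -mem_f.
apply/memv_imgP/idP => [[x xU]|gyU]; last by exists (g y); rewrite ?lfunE.
by rewrite lfunE => /= /(can_inj fK) ->.
Qed.

(** * Coordinate subspaces and the annihilator series of a structure matrix *)

Section CoordinateSubspaces.

Variables (F : fieldType) (n : nat).
Implicit Types (P : pred 'I_n) (M : 'M[F]_n).

Definition coord_space P : {vspace 'rV[F]_n} :=
  <<[seq delta_mx 0%R i | i <- enum P]>>%VS.

Lemma dim_coord_space P : \dim (coord_space P) = #|P|.
Proof.
pose delta (i : 'I_n) : 'rV[F]_n := delta_mx 0 i.
have free_delta : free (map delta (enum 'I_n)).
  suff: basis_of fullv (map delta (enum 'I_n)) by apply: basis_free.
  rewrite basisEdim size_map size_enum_ord dimvf /dim /= mul1n leqnn andbT.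
  apply/subvP => x _; rewrite [x]row_sum_delta memv_suml // => i _.
  by rewrite memvZ // memv_span // map_f ?mem_enum.
suff /eqnP-> : free (map delta (enum P)) by rewrite size_map cardE.
apply: (@catl_free _ _ (map delta (filter (predC P) (enum 'I_n)))).
rewrite -map_cat enumT -(perm_free (X := map delta (enum 'I_n))) //.
by rewrite perm_map // perm_sym enumT; apply: permEl; apply: perm_filterC.
Qed.

Lemma mem_coord_space P (x : 'rV[F]_n) :
  reflect (forall i, ~~ P i -> x 0 i = 0) (x \in coord_space P).
Proof.
apply: (iffP idP) => [xP i nPi | x0].
  suff /subvP/(_ x xP) : (coord_space P <= lker (linfun (col i)))%VS.
    rewrite memv_ker lfunE /= => /eqP/matrixP/(_ 0 0).
    by rewrite !mxE.
  apply/span_subvP => _ /mapP[j Pj ->].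
  rewrite memv_ker lfunE; apply/eqP/matrixP => k l; rewrite !mxE.
  have [eq_ij | _] := eqVneq i j; rewrite ?andbF //.
  by move: Pj; rewrite mem_enum unfold_in -eq_ij (negPf nPi).
rewrite [x]row_sum_delta memv_suml // => i _.
have [Pi | /x0->] := boolP (P i); last by rewrite scale0r mem0v.
by rewrite memvZ // memv_span // map_f // mem_enum.
Qed.

(** The product of x with the i-th basis vector is x_i times row i of [M]. Hence x_i must vanish as
    soon as row i has a nonzero entry outside [P], and no other condition arises. The annihilator
    series therefore stays among coordinate subspaces. *)
Lemma transporter_coord_space M P :
  transporter (evo_mul M) (coord_space P) =
  coord_space [pred i | [forall k, P k || (M i k == 0)]].
Proof.
apply/vspaceP => x; apply/mem_transporter/mem_coord_space => [xW i /forallPn[k]|].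
  rewrite negb_or => /andP[nPk Mik].
  have [/mem_coord_space/(_ k nPk) + _] := xW (delta_mx 0 i).
  rewrite /evo_mul !mxE (bigD1 i) //= big1 ?addr0 => [|j ne_ji].
    by rewrite !mxE !eqxx mulr1 => /eqP; rewrite mulf_eq0 (negPf Mik) orbF => /eqP.
  by rewrite !mxE (negPf ne_ji) mulr0 mul0r.
move=> x0 y; suff xz z : map2_mx *%R x z *m M \in coord_space P.
  split; first exact: xz.
  have mulC : map2_mx *%R x y = map2_mx *%R y x.
    by apply/rowP => i; rewrite !mxE mulrC.
  by have := xz y; rewrite mulC.
apply/mem_coord_space => k nPk; rewrite !mxE big1 // => i _; rewrite !mxE.
have [/forallP/(_ k) | /x0->] := boolP [forall k, P k || (M i k == 0)].
  by rewrite (negPf nPk) => /eqP->; rewrite mulr0.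
by rewrite !mul0r.
Qed.

Lemma coord_space_pred0 : coord_space pred0 = 0%VS.
Proof. by rewrite /coord_space enum0 span_nil. Qed.

Lemma eq_coord_space P Q : P =1 Q -> coord_space P = coord_space Q.
Proof. by move=> eqPQ; rewrite /coord_space (eq_enum eqPQ). Qed.

End CoordinateSubspaces.

(** * Recognising an algebra from the squares of a natural basis *)

Section IsoToModel.

Variables (F : fieldType) (E : vectType F) (mul : {bilinear E -> E -> E}).
Variables (n : nat) (b : n.-tuple E).

Definition coord_row (x : E) : 'rV[F]_n := \row_i coord b i x.

Lemma coord_row_is_linear : linear coord_row.
Proof. by move=> a x y; apply/rowP => i; rewrite !mxE linearP. Qed.

HB.instance Definition _ := GRing.isSemilinear.Build F _ _ _ coord_row
  (GRing.semilinear_linear coord_row_is_linear).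

Lemma alg_isomorphic_evo_mul (M : 'M[F]_n) :
  is_natural_basis mul b ->
  (forall i, mul (tnth b i) (tnth b i) = \sum_j M i j *: tnth b j) ->
  alg_isomorphic mul (evo_mul M).
Proof.
case=> b_basis b_orth b_sq; exists coord_row; split.
  exists (fun v : 'rV_n => \sum_(i < n) v 0 i *: b`_i) => [x | v].
    rewrite [RHS](coord_basis b_basis (memvf x)).
    by apply: eq_bigr => i _; rewrite mxE.
  by apply/rowP => i; rewrite mxE coord_sum_free ?(basis_free b_basis).
have bE x : x = \sum_i coord_row x 0 i *: tnth b i.
  rewrite [LHS](coord_basis b_basis (memvf x)).
  by apply: eq_bigr => i _; rewrite mxE (tnth_nth 0).
move=> x y; rewrite {1}[x]bE {1}[y]bE.
rewrite linear_sumlz [LHS]linear_sum /= /evo_mul mulmx_sum_row.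
apply: eq_bigr => i _; rewrite linear_sumr (bigD1 i) //= big1; last first.
  by move=> j ne_ji; rewrite linearZl_LR linearZr_LR /= b_orth ?scaler0 // eq_sym.
rewrite linearZl_LR linearZr_LR /= b_sq addr0 scalerA linearZ /=.
congr (_ *: _); first by rewrite !mxE.
rewrite linear_sum /=; apply/rowP => k; rewrite summxE (bigD1 k) //= big1.
  by rewrite !mxE linearZ /= (tnth_nth 0) coord_free ?(basis_free b_basis) //
    eqxx mulr1 addr0.
move=> j ne_jk; rewrite !mxE linearZ /= (tnth_nth 0) coord_free ?(basis_free b_basis) //.
by rewrite (negPf ne_jk) mulr0.
Qed.

End IsoToModel.

(** * Types of the three models and their pairwise non-isomorphism *)

Section ModelTypes.

Variable F : fieldType.

(* Indices start at 0 here: the basis vector e_k of Defs has index k - 1.     *)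
Definition entries23 (i j : nat) : bool :=
  (i, j) \in [:: (0, 3); (1, 3); (1, 4); (2, 4)]%N.
Definition entries221 (i j : nat) : bool :=
  (i, j) \in [:: (0, 1); (0, 2); (1, 3); (2, 4)]%N.
Definition entries212 (i j : nat) : bool :=
  (i, j) \in [:: (0, 2); (1, 2); (1, 4); (2, 3)]%N.

Lemma M23E i j : M23 F i j = (entries23 i j)%:R.
Proof.
case: i => [[|[|[|[|[|//]]]]] ilt]; case: j => [[|[|[|[|[|//]]]]] jlt];
  by rewrite mxE (tnth_nth 0) /= !mxE -?val_eqE /= ?inordK // ?addr0 ?add0r.
Qed.

Lemma M221E i j : M221 F i j = (entries221 i j)%:R.
Proof.
case: i => [[|[|[|[|[|//]]]]] ilt]; case: j => [[|[|[|[|[|//]]]]] jlt];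
  by rewrite mxE (tnth_nth 0) /= !mxE -?val_eqE /= ?inordK // ?addr0 ?add0r.
Qed.

Lemma M212E i j : M212 F i j = (entries212 i j)%:R.
Proof.
case: i => [[|[|[|[|[|//]]]]] ilt]; case: j => [[|[|[|[|[|//]]]]] jlt];
  by rewrite mxE (tnth_nth 0) /= !mxE -?val_eqE /= ?inordK // ?addr0 ?add0r.
Qed.

(* If ann^j is spanned by the basis vectors with index in P, then ann^(j+1)   *)
(* is spanned by those with index in ann_step b P.                            *)
Definition ann_step (b : nat -> nat -> bool) (P : pred nat) : pred nat :=
  [pred i | all (fun k => P k || ~~ b i k) (iota 0 5)].

(** For a 0/1 matrix the series depends only on the position of the ones, since 1 is nonzero in
    every field. The right-hand side is a closed boolean computation that does not mention [F], so
    [vm_compute] can evaluate it. *)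
Lemma dim_upper_ann_entries (M : 'M[F]_5) (b : nat -> nat -> bool) k :
  (forall i j : 'I_5, M i j = (b i j)%:R) ->
  \dim (upper_ann (evo_mul M) k) = count (iter k (ann_step b) pred0) (iota 0 5).
Proof.
move=> ME; pose P j := [pred i : 'I_5 | iter j (ann_step b) pred0 i].
have -> : upper_ann (evo_mul M) k = coord_space F (P k).
  elim: k => [|k /= ->]; first exact/esym/coord_space_pred0.
  rewrite transporter_coord_space; apply: eq_coord_space => i /=.
  apply/forallP/allP => [h j | h j].
    rewrite mem_iota => /= jlt; have := h (Ordinal jlt).
    by rewrite ME; case: (b i _); rewrite ?oner_eq0 ?orbF ?orbT.
  have := h j; rewrite mem_iota => /(_ (ltn_ord j)).
  by rewrite ME; case: (b i _); rewrite ?oner_eq0 ?eqxx ?orbF ?orbT.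
rewrite dim_coord_space -val_enum_ord count_map cardE size_filter.
by rewrite enumT; apply: eq_count.
Qed.

Lemma has_type_entries (M : 'M[F]_5) (b : nat -> nat -> bool) s :
  (forall i j : 'I_5, M i j = (b i j)%:R) ->
  let d k := count (iter k (ann_step b) pred0) (iota 0 5) in
  d (size s) = 5%N -> all (fun r => d r != 5%N) (iota 0 (size s)) ->
  s = mkseq (fun j => d j.+1 - d j)%N (size s) ->
  has_type (evo_mul M) s.
Proof.
move=> ME d ds dlt sE; have dE k : \dim (upper_ann (evo_mul M) k) = d k.
  exact: dim_upper_ann_entries.
split.
- by apply/eqP; rewrite eqEdim subvf dE ds dimvf.
- move=> r rfull; rewrite leqNgt; apply/negP => r_lt.
  have /allP/(_ r) := dlt; rewrite mem_iota => /(_ r_lt) /eqP; apply.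
  by rewrite -dE rfull dimvf.
- by move=> j jlt; rewrite !dE {1}sE nth_mkseq.
Qed.

Lemma has_type_models :
  [/\ has_type (evo_mul (M23 F)) [:: 2; 3]%N,
      has_type (evo_mul (M221 F)) [:: 2; 2; 1]%N &
      has_type (evo_mul (M212 F)) [:: 2; 1; 2]%N].
Proof.
by split; [apply: (has_type_entries M23E) | apply: (has_type_entries M221E)
  | apply: (has_type_entries M212E)]; vm_compute.
Qed.

(** The invariant dim ann^2 equals 5, 4, 3 on the models of index 0, 1, 2, that is 5 minus the
    index. *)
Lemma alg_isomorphic_model_inj (E : vectType F) (mul : {bilinear E -> E -> E})
    (i j : 'I_3) :
  alg_isomorphic mul (evo_mul (model F i)) ->
  alg_isomorphic mul (evo_mul (model F j)) -> i = j.
Proof.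
have dim2 (k : 'I_3) : \dim (upper_ann (evo_mul (model F k)) 2) = (5 - k)%N.
  case: k => [[|[|[|//]]] klt]; rewrite /model (tnth_nth 0) /=.
  - by rewrite (dim_upper_ann_entries 2 M23E); vm_compute.
  - by rewrite (dim_upper_ann_entries 2 M221E); vm_compute.
  - by rewrite (dim_upper_ann_entries 2 M212E); vm_compute.
move=> /(dim_upper_ann_iso 2) + /(dim_upper_ann_iso 2).
rewrite !dim2 => -> eq_ij; apply: val_inj.
have le5 (k : 'I_3) : (k <= 5)%N
  by apply: leq_trans (ltnW (ltn_ord k)) _.
by rewrite /= -(subKn (le5 i)) eq_ij subKn.
Qed.

End ModelTypes.

(** * Nilpotency, decomposability and the annihilator of an evolution algebra *)

Section EvolutionAlgebra.

Variables (F : fieldType) (E : vectType F) (mul : {bilinear E -> E -> E}).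
Implicit Types (s t : seq E) (x y z u : E).

Lemma mulv_powerv i j : (0 < i)%N -> (0 < j)%N ->
  (mulv mul (powerv mul i) (powerv mul j) <= powerv mul (i + j))%VS.
Proof.
case: i j => // i [// | j] _ _; rewrite addSn (@powervS _ _ mul (i + j.+1)) ?addnS //.
have i_in : i.+1 \in index_iota 1 (i + j).+2.
  by rewrite mem_index_iota /= !ltnS leq_addr.
by rewrite (bigD1_seq i.+1) ?iota_uniq //= subSS -addnS addKn addvSl.
Qed.

(** If [l] is nonzero then z = l^-1 (z x), and iterating this places z in every power of the
    algebra, hence in the zero one. *)
Lemma nilpotent_mul_eigen x z (l : F) :
  nilpotent mul -> mul z x = l *: z -> l = 0 \/ z = 0.
Proof.
case=> m m_gt0 m0 zx; have [->|l0] := eqVneq l 0; [by left | right].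
suff zk k : z \in powerv mul k.+1.
  by apply/eqP; rewrite -memv0 -m0 -(prednK m_gt0).
elim: k => [|k IH]; first exact: memvf.
have -> : z = l^-1 *: mul z x by rewrite zx scalerA mulVf ?scale1r.
rewrite memvZ //; have /mulvP h := @mulv_powerv k.+1 1 isT isT.
by rewrite -addn1; apply: h; rewrite ?memvf.
Qed.

(** The last nonzero power annihilates: multiplying it by the algebra on either side lands in the
    next power, which is zero. *)
Lemma nilpotent_ann_neq0 : nilpotent mul -> \dim {:E} != 0%N -> ann mul != 0%VS.
Proof.
case=> m m_gt0 m0 E0.
have ex0 : exists k, powerv mul k.+1 == 0%VS.
  by exists m.-1; rewrite prednK // m0.
case: (ex_minnP ex0) => [[|k]] /eqP pk0 kmin.
  by rewrite -(powerv1 mul) pk0 dimv0 in E0.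
apply/eqP => ann0; have: powerv mul k.+1 != 0%VS.
  by apply/negP => /kmin; rewrite ltnn.
rewrite -subv0 -ann0 => /subvPn[x xk] /annP[] y.
have /mulvP hr := @mulv_powerv k.+1 1 isT isT.
have /mulvP hl := @mulv_powerv 1 k.+1 isT isT.
split; apply/eqP; rewrite -memv0 -pk0.
  by rewrite -addn1; apply: hr; rewrite ?memvf.
by rewrite -add1n; apply: hl; rewrite ?memvf.
Qed.

Lemma span_mulvP s t (W : {vspace E}) :
  reflect {in s & t, forall x y, mul x y \in W} (mulv mul <<s>> <<t>> <= W)%VS.
Proof.
apply: (iffP (mulvP _ _ _ _)) => [h x y xs yt | h x y xs yt].
  by apply: h; apply: memv_span.
have xy x' y' : x' \in s -> y' \in <<t>>%VS -> mul x' y' \in W.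
  move=> x's /(coord_span (X := in_tuple t))->; rewrite linear_sumr memv_suml // => j _.
  by rewrite linearZr_LR memvZ // h // mem_nth.
rewrite (coord_span (X := in_tuple s) xs) linear_sumlz memv_suml // => i _.
by rewrite linearZl_LR memvZ // xy // mem_nth.
Qed.

(** A spanning list of at most dim E vectors is a basis, so the two spans are complementary.
    Products within each list staying in its span, and cross products vanishing, make both spans
    ideals. Every splitting below goes through this criterion. *)
Lemma decomposable_cat s t :
  <<s ++ t>>%VS = fullv -> (size (s ++ t) <= \dim {:E})%N ->
  (0 < size s)%N -> (0 < size t)%N ->
  {in s &, forall x y, mul x y \in <<s>>%VS} ->
  {in t &, forall x y, mul x y \in <<t>>%VS} ->
  {in s & t, forall x y, mul x y = 0 /\ mul y x = 0} ->
  decomposable mul.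
Proof.
move=> st_full st_size s0 t0 ss tt st0.
have: basis_of fullv (s ++ t) by rewrite basisEdim st_full subvv.
move/basis_free; rewrite cat_free => /and3P[free_s free_t direct_st].
have ideal (p q : seq E) : <<p ++ q>>%VS = fullv ->
    {in p &, forall x y, mul x y \in <<p>>%VS} ->
    {in p & q, forall x y, mul x y = 0 /\ mul y x = 0} -> is_ideal mul <<p>>%VS.
  move=> pq_full pp pq0.
  have /mulvP hr : (mulv mul <<p>> fullv <= <<p>>)%VS.
    apply: subv_trans (_ : mulv mul <<p>> <<p ++ q>> <= _)%VS.
      by rewrite pq_full.
    apply/span_mulvP => x y xp; rewrite mem_cat => /orP[yp | yq]; first exact: pp.
    by have [-> _] := pq0 x y xp yq; rewrite mem0v.
  have /mulvP hl : (mulv mul fullv <<p>> <= <<p>>)%VS.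
    apply: subv_trans (_ : mulv mul <<p ++ q>> <<p>> <= _)%VS.
      by rewrite pq_full.
    apply/span_mulvP => y x; rewrite mem_cat => /orP[yp | yq] xp; first exact: pp.
    by have [_ ->] := pq0 x y xp yq; rewrite mem0v.
  by move=> x y xp; split; [apply: hr | apply: hl]; rewrite ?memvf.
exists <<s>>%VS, <<t>>%VS; split.
- split; first exact: ideal st_full ss st0.
  by rewrite -dimv_eq0 (eqnP free_s) -lt0n.
- split; last by rewrite -dimv_eq0 (eqnP free_t) -lt0n.
  apply: (ideal t s) tt _; first by rewrite span_cat addvC -span_cat.
  by move=> x y xt ys; have [] := st0 y x ys xt.
- by rewrite -span_cat.
- exact/directv_addP.
Qed.

Lemma indecomposable_ann_sub_sqr :
  indecomposable mul -> (1 < \dim {:E})%N -> (ann mul <= mulv mul fullv fullv)%VS.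
Proof.
move=> indec dimE; apply/subvP => x xann; apply/negPn/negP => xW.
set W := mulv _ _ _ in xW; apply: indec.
have x0 : x != 0 by apply: contraNneq xW => ->; rewrite mem0v.
have /annP xmul := xann.
(* [J] contains all products, so it is an ideal, and together with [x] it spans the algebra. As [x]
   is outside [W], the complement has dimension dim E - dim W - 1, which makes [J] proper. *)
pose J := (W + (<[x]> + W)^C)%VS.
have xJ : (<[x]> + J)%VS = fullv by rewrite addvA addv_complf.
have dimxW : \dim (<[x]> + W) = (\dim W).+1.
  rewrite dimv_disjoint_sum ?dim_vline ?x0 //.
  apply/eqP; rewrite -subv0; apply/subvP => y /memv_capP[/vlineP[k ->] kxW].
  have [->|k0] := eqVneq k 0; first by rewrite scale0r mem0v.
  by have := memvZ k^-1 kxW; rewrite scalerA mulVf // scale1r (negPf xW).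
have WJ : (W <= J)%VS := addvSl _ _.
have dimJ : (\dim J < \dim {:E})%N.
  apply: leq_ltn_trans (dimv_add_leqif _ _) _.
  rewrite dimv_compl dimxW.
  have : (\dim (<[x]> + W) <= \dim {:E})%N by rewrite dimvS ?subvf.
  rewrite dimxW => le; by rewrite -ltnS -addSn subnKC.
apply: (@decomposable_cat [:: x] (vbasis J)) => //.
- by rewrite span_cat span_seq1 (span_basis (vbasisP J)).
- by rewrite /= size_tuple.
- rewrite size_tuple lt0n; apply: contraTneq dimE => J0.
  by rewrite -leqNgt -xJ (leq_trans (dimv_add_leqif _ _)) // J0 addn0 dim_vline leq_b1.
- by move=> y z; rewrite inE => /eqP-> _; have [-> _] := xmul z; rewrite mem0v.
- move=> y z _ _; rewrite (span_basis (vbasisP J)); apply: (subvP WJ).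
  by have /mulvP h := subvv W; apply: h; rewrite memvf.
- by move=> y z; rewrite inE => /eqP->.
Qed.

Variables (n : nat) (e : n.-tuple E).
Hypothesis e_nat : is_natural_basis mul e.

Let free_e : free e := basis_free e_nat.1.
Let span_e : <<e>>%VS = fullv := span_basis e_nat.1.

Lemma natural_basis_orth : {in e &, forall x y, x != y -> mul x y = 0}.
Proof.
move=> x y /tnthP[i ->] /tnthP[j ->] ne_ij; apply: e_nat.2.
by apply: contraNneq ne_ij => ->.
Qed.

Definition null_basis := [seq x <- e | mul x x == 0].
Definition nonnull_basis := [seq x <- e | mul x x != 0].

(** Multiplying x by a basis vector e_i leaves only the i-th coordinate of x times e_i^2. So a
    vector of the annihilator has no component along any e_i with nonzero square. *)
Lemma span_null_basis : <<null_basis>>%VS = ann mul.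
Proof.
apply: subv_anti; apply/andP; split.
  apply/span_subvP => x; rewrite mem_filter => /andP[/eqP xx0 xe].
  have mulx y : y \in e -> mul x y = 0 /\ mul y x = 0.
    have [<- _ | ne_xy ye] := eqVneq x y; first by rewrite xx0.
    by split; apply: natural_basis_orth => //; rewrite eq_sym.
  have /mulvP hl : (mulv mul <<[:: x]>> <<e>> <= 0)%VS.
    by apply/span_mulvP => z y; rewrite inE => /eqP-> /mulx[-> _]; rewrite mem0v.
  have /mulvP hr : (mulv mul <<e>> <<[:: x]>> <= 0)%VS.
    by apply/span_mulvP => y z /mulx[_ yx]; rewrite inE => /eqP->; rewrite yx mem0v.
  apply/annP => y; split; apply/eqP; rewrite -memv0; [apply: hl | apply: hr];
    by rewrite ?memv_span1 // span_e memvf.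
apply/subvP => x /annP xann; rewrite (coord_basis e_nat.1 (memvf x)).
apply: memv_suml => i _; have ei : e`_i \in e := memt_nth 0 _ (ltn_ord i).
have [sq0 | sq_neq0] := eqVneq (mul e`_i e`_i) 0.
  by rewrite memvZ // memv_span // mem_filter sq0 eqxx.
suff -> : coord e i x = 0 by rewrite scale0r mem0v.
have [+ _] := xann e`_i; rewrite {1}(coord_basis e_nat.1 (memvf x)).
rewrite linear_sumlz (bigD1 i) //= big1 => [|j ne_ji]; last first.
  by rewrite linearZl_LR /= -!tnth_nth e_nat.2 ?scaler0.
by rewrite addr0 linearZl_LR /= => /eqP; rewrite scaler_eq0 (negPf sq_neq0) orbF => /eqP.
Qed.

Lemma perm_null_nonnull : perm_eq (nonnull_basis ++ null_basis) e.
Proof. by rewrite perm_catC; apply: permEl; apply: perm_filterC. Qed.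

Lemma dim_ann : \dim (ann mul) = size null_basis.
Proof. by rewrite -span_null_basis; apply/eqnP/filter_free. Qed.

Lemma size_nonnull : (size nonnull_basis + \dim (ann mul))%N = \dim {:E}.
Proof.
by rewrite dim_ann -size_cat (perm_size perm_null_nonnull) size_tuple (size_basis e_nat.1).
Qed.

Lemma sqr_sub_nonnull :
  (mulv mul fullv fullv <= <<[seq mul x x | x <- nonnull_basis]>>)%VS.
Proof.
apply/mulvP => x y _ _; rewrite (coord_basis e_nat.1 (memvf x)).
rewrite (coord_basis e_nat.1 (memvf y)) linear_sumlz memv_suml // => i _.
rewrite linearZl_LR memvZ // linear_sumr memv_suml // => j _.
rewrite linearZr_LR memvZ //= -!tnth_nth.
have [<- | ne_ij] := eqVneq i j; last by rewrite e_nat.2 // mem0v.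
have [-> | sq0] := eqVneq (mul (tnth e i) (tnth e i)) 0; first exact: mem0v.
apply: memv_span; apply/mapP; exists (tnth e i) => //.
by rewrite mem_filter sq0 mem_tnth.
Qed.

End EvolutionAlgebra.

(** * Spans of short lists and square roots *)

Lemma span_consP (F : fieldType) (E : vectType F) (v x : E) (s : seq E) :
  x \in <<v :: s>>%VS -> exists k, x - k *: v \in <<s>>%VS.
Proof.
rewrite span_cons => /memv_addP[_ /vlineP[k ->] [w sw ->]].
by exists k; rewrite addrAC subrr add0r.
Qed.

Lemma span3P (F : fieldType) (E : vectType F) (p q r x : E) :
  x \in <<[:: p; q; r]>>%VS ->
  exists k l m, x = k *: p + l *: q + m *: r.
Proof.
case/span_consP=> k /span_consP[l]; rewrite span_seq1 => /vlineP[m xE].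
by exists k, l, m; rewrite -xE -[x - _ - _]addrA -opprD [RHS]addrC subrK.
Qed.

Lemma memv_scale_neq0 (F : fieldType) (E : vectType F) (U : {vspace E}) k x :
  k != 0 -> k *: x \in U -> x \in U.
Proof. by move=> k0 /(memvZ k^-1); rewrite scalerA mulVf // scale1r. Qed.

Lemma exists_sqrt (F : closedFieldType) (k : F) : exists x, x * x = k.
Proof.
(* The coefficient list has [k] in degree 0 and the default 0 in degree 1, so the equation solved is
   x^2 = k. *)
have [x] := @solve_monicpoly F 2 (nth 0 [:: k]) isT.
rewrite !big_ord_recl big_ord0 /= expr0 mulr1 mul0r !addr0 => xE.
by exists x; rewrite -expr2.
Qed.

(** * Frames: bases modulo a two-dimensional annihilator *)

Section Frames.

Variables (F : closedFieldType) (E : vectType F) (mul : {bilinear E -> E -> E}).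
Implicit Types (a b c u v : E).

(** This keeps of a natural basis only the three vectors with nonzero square, with no choice of
    basis of the annihilator. The notion is stable under permuting [a], [b], [c] ([frame_swap],
    [frame_rot]), which allows cases to be treated up to symmetry. The last field records what
    indecomposability gives. *)
Record frame a b c : Prop := Frame {
  frame_span : (<<[:: a; b; c]>> + ann mul)%VS = fullv;
  frame_free : forall k l m, k *: a + l *: b + m *: c \in ann mul ->
    [/\ k = 0, l = 0 & m = 0];
  frame_orth : [/\ mul a b = 0 /\ mul b a = 0, mul a c = 0 /\ mul c a = 0 &
    mul b c = 0 /\ mul c b = 0];
  frame_sqr : (ann mul <= <<[:: mul a a; mul b b; mul c c]>>)%VS
}.

Lemma frame_swap a b c : frame a b c -> frame b a c.
Proof.
case=> sp fr [[ab ba] [ac ca] [bc cb]] sq; split => //.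
- by rewrite -sp; congr (_ + _)%VS; apply: eq_span => x; rewrite !inE orbCA.
- by move=> k l m; rewrite [k *: b + _]addrC => /fr[].
- apply: subv_trans sq _; apply: sub_span => x.
  by rewrite !inE => /or3P[] ->; rewrite ?orbT.
Qed.

Lemma frame_rot a b c : frame a b c -> frame b c a.
Proof.
case=> sp fr [[ab ba] [ac ca] [bc cb]] sq; split => //.
- by rewrite -sp; congr (_ + _)%VS; apply: eq_span => x; rewrite !inE orbA orbC.
- by move=> k l m; rewrite addrC addrA => /fr[].
- apply: subv_trans sq _; apply: sub_span => x.
  by rewrite !inE => /or3P[] ->; rewrite ?orbT.
Qed.

Lemma ann_mul u : u \in ann mul ->
  (forall x, mul u x = 0) * (forall x, mul x u = 0).
Proof. by move/annP => u0; split=> x; have [] := u0 x. Qed.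

Hypothesis dimE : \dim {:E} = 5%N.
Hypothesis dim_annE : \dim (ann mul) = 2%N.
Hypothesis indec : indecomposable mul.

Lemma frame_span_full a b c (s : seq E) : frame a b c ->
  a \in <<s>>%VS -> b \in <<s>>%VS -> c \in <<s>>%VS -> (ann mul <= <<s>>)%VS ->
  <<s>>%VS = fullv.
Proof.
move=> abc sa sb sc s_ann; apply: subv_anti; rewrite subvf -(frame_span abc).
rewrite subv_add s_ann andbT; apply/span_subvP => x.
by rewrite !inE => /or3P[] /eqP->.
Qed.

Lemma frame_basis a b c (s : 5.-tuple E) : frame a b c ->
  a \in <<s>>%VS -> b \in <<s>>%VS -> c \in <<s>>%VS -> (ann mul <= <<s>>)%VS ->
  basis_of fullv s.
Proof.
move=> abc sa sb sc s_ann; rewrite basisEdim (frame_span_full abc) //.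
by rewrite subvv size_tuple dimE.
Qed.

(** * Normal forms and splittings according to the squares of a frame *)

Definition classified := exists i : 'I_3, alg_isomorphic mul (evo_mul (model F i)).

(** Replacing [a] and [c] by their multiples by square roots of [k] and [l] turns their squares into
    k a^2 and l c^2. These serve as e_4 and e_5, and their sum is b^2. *)
Lemma classified23 a b c (k l : F) : frame a b c ->
  mul a a \in ann mul -> mul b b \in ann mul -> mul c c \in ann mul ->
  k != 0 -> l != 0 -> mul b b = k *: mul a a + l *: mul c c ->
  classified.
Proof.
move=> abc /ann_mul a2 /ann_mul b2 /ann_mul c2 k0 l0 bE.
have [[ab ba] [ac ca] [bc cb]] := frame_orth abc.
have [x xx] := exists_sqrt k; have [y yy] := exists_sqrt l.
have x0 : x != 0 by apply: contraNneq k0 => x0; rewrite -xx x0 mul0r.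
have y0 : y != 0 by apply: contraNneq l0 => y0; rewrite -yy y0 mul0r.
pose s := [tuple x *: a; b; y *: c; k *: mul a a; l *: mul c c].
have sP z : z \in tval s -> z \in <<s>>%VS by apply: memv_span.
exists 0; rewrite /model (tnth_nth 0) /=; apply: (@alg_isomorphic_evo_mul _ _ _ _ s).
  split.
    have a2s : mul a a \in <<s>>%VS.
      by apply: (memv_scale_neq0 k0); apply: sP; rewrite !inE eqxx ?orbT.
    have c2s : mul c c \in <<s>>%VS.
      by apply: (memv_scale_neq0 l0); apply: sP; rewrite !inE eqxx ?orbT.
    apply: (frame_basis abc).
    - by apply: (memv_scale_neq0 x0); apply: sP; rewrite !inE eqxx ?orbT.
    - by apply: sP; rewrite !inE eqxx ?orbT.
    - by apply: (memv_scale_neq0 y0); apply: sP; rewrite !inE eqxx ?orbT.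
    - apply: subv_trans (frame_sqr abc) _; apply/span_subvP => z.
      by rewrite !inE => /or3P[] /eqP-> //; rewrite bE memvD // memvZ.
  case=> [[|[|[|[|[|//]]]]] jlt]; case=> [[|[|[|[|[|//]]]]] klt] // _;
    rewrite !(tnth_nth 0) /= ?linearZl_LR ?linearZr_LR /=;
    by rewrite ?(ab, ba, ac, ca, bc, cb, a2, c2) ?scaler0.
case=> [[|[|[|[|[|//]]]]] ilt]; rewrite !big_ord_recl big_ord0 !M23E /=;
  rewrite !(tnth_nth 0) /= ?scale0r ?scale1r ?addr0 ?add0r //;
  by rewrite ?linearZl_LR ?linearZr_LR /= ?a2 ?c2 ?scaler0 ?scalerA ?xx ?yy.
Qed.

(** If a^2 were a multiple of b^2, then b^2 and c^2 would already span the annihilator, and E would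
    split as the span of a, b, b^2 plus the span of c, c^2. *)
Lemma indecomposable_sqr_free a b c : frame a b c ->
  mul a a \in ann mul -> mul b b \in ann mul -> mul c c \in ann mul ->
  forall k, mul a a != k *: mul b b.
Proof.
move=> abc /ann_mul a2 /ann_mul b2 /ann_mul c2 k; apply/eqP => aE; apply: indec.
have [[ab ba] [ac ca] [bc cb]] := frame_orth abc.
have s_full : <<[:: a; b; mul b b] ++ [:: c; mul c c]>>%VS = fullv.
  have sP z : z \in [:: a; b; mul b b] ++ [:: c; mul c c] ->
    z \in <<[:: a; b; mul b b] ++ [:: c; mul c c]>>%VS by apply: memv_span.
  apply: (frame_span_full abc); rewrite ?sP ?inE ?eqxx ?orbT //.
  apply: subv_trans (frame_sqr abc) _; apply/span_subvP => z.
  by rewrite !inE => /or3P[] /eqP->; rewrite ?aE ?memvZ // sP // !inE eqxx ?orbT.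
apply: (decomposable_cat s_full); rewrite ?dimE //.
- move=> y z; rewrite !inE => /or3P[] /eqP-> /or3P[] /eqP->;
    rewrite ?(ab, ba, b2) ?mem0v ?aE ?memvZ //;
    by apply: memv_span; rewrite !inE eqxx ?orbT.
- move=> y z; rewrite !inE => /orP[] /eqP-> /orP[] /eqP->;
    rewrite ?c2 ?mem0v //;
    by apply: memv_span; rewrite !inE eqxx ?orbT.
- by move=> y z; rewrite !inE => /or3P[] /eqP-> /orP[] /eqP->;
    rewrite ?(ac, ca, bc, cb, b2, c2).
Qed.

(** No square is a multiple of another. So a^2 and c^2 form a basis of the two-dimensional
    annihilator, and both coefficients of b^2 in it are nonzero. *)
Lemma classified_sqr_ann a b c : frame a b c ->
  mul a a \in ann mul -> mul b b \in ann mul -> mul c c \in ann mul -> classified.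
Proof.
move=> abc a2 b2 c2.
have acb := frame_swap (frame_rot (frame_rot abc)).
have cba := frame_rot (frame_rot (frame_swap abc)).
have bca := frame_rot abc.
have ac_free : free [:: mul a a; mul c c].
  rewrite free_cons seq1_free span_seq1; apply/andP; split.
    apply/negP => /vlineP[k aE].
    by have /eqP := indecomposable_sqr_free acb a2 c2 b2 k.
  apply: contraTneq isT => c0.
  by have := indecomposable_sqr_free cba c2 b2 a2 0; rewrite c0 scale0r eqxx.
have : mul b b \in <<[:: mul a a; mul c c]>>%VS.
  have <- : ann mul = <<[:: mul a a; mul c c]>>%VS; last by [].
  apply/esym/eqP; rewrite eqEdim (eqnP ac_free) dim_annE leqnn andbT.
  by apply/span_subvP => z; rewrite !inE => /orP[] /eqP->.
case/span_consP=> k; rewrite span_seq1 => /vlineP[l /eqP]; rewrite subr_eq addrC => /eqP bE.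
apply: (classified23 abc a2 b2 c2 _ _ bE).
  apply: contraTneq isT => k0; move: bE; rewrite k0 scale0r add0r => /eqP.
  by rewrite (negPf (indecomposable_sqr_free bca b2 c2 a2 l)).
apply: contraTneq isT => l0; move: bE; rewrite l0 scale0r addr0 => /eqP.
by rewrite (negPf (indecomposable_sqr_free (frame_swap abc) b2 a2 c2 k)).
Qed.


(* A combination of the squares that lies in the annihilator does not involve *)
(* a^2, because a^2 has a component along b or c.                             *)
Lemma ann_sub_sqr_tail a b c u (k l : F) : frame a b c ->
  u \in ann mul -> mul b b \in ann mul -> mul c c \in ann mul ->
  mul a a = k *: b + l *: c + u -> (k != 0) || (l != 0) ->
  (ann mul <= <<[:: mul b b; mul c c]>>)%VS.
Proof.
move=> abc u0 b2 c2 aE kl0; apply/subvP => x xann.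
have /span3P[p [q [r xE]]] := subvP (frame_sqr abc) _ xann.
have : 0 *: a + (p * k) *: b + (p * l) *: c \in ann mul.
  have -> : 0 *: a + (p * k) *: b + (p * l) *: c =
      x - (q *: mul b b + r *: mul c c) - p *: u.
    rewrite xE -[_ + _ + r *: _]addrA addrK aE !scalerDr !scalerA addrK.
    by rewrite scale0r add0r.
  by rewrite !memvB ?memvD ?memvZ.
case/(frame_free abc) => _ pk pl.
have p0 : p = 0.
  move: pk pl kl0 => /eqP + /eqP; rewrite !mulf_eq0.
  by have [// | _] := eqVneq p 0; move=> /= -> ->.
rewrite xE p0 scale0r add0r memvD // memvZ // memv_span // !inE eqxx ?orbT //.
Qed.

(** The basis is a, k b + u, l c, k^2 b^2, l^2 c^2. The annihilator part [u] of a^2 is absorbed into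
    the second vector, whose square it does not affect. *)
Lemma classified221 a b c u (k l : F) : frame a b c ->
  u \in ann mul -> mul b b \in ann mul -> mul c c \in ann mul ->
  mul a a = k *: b + l *: c + u -> k != 0 -> l != 0 -> classified.
Proof.
move=> abc u_ann b2_ann c2_ann aE k0 l0.
have ann_sub : (ann mul <= <<[:: mul b b; mul c c]>>)%VS.
  by apply: (ann_sub_sqr_tail abc u_ann b2_ann c2_ann aE); rewrite k0.
have [[u0 b2] c2] := (ann_mul u_ann, ann_mul b2_ann, ann_mul c2_ann).
have [[ab ba] [ac ca] [bc cb]] := frame_orth abc.
pose s := [tuple a; k *: b + u; l *: c; (k * k) *: mul b b; (l * l) *: mul c c].
have sP z : z \in tval s -> z \in <<s>>%VS by apply: memv_span.
exists (inord 1); rewrite /model (tnth_nth 0) inordK //=.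
apply: (@alg_isomorphic_evo_mul _ _ _ _ s).
  split.
    have b2s : mul b b \in <<s>>%VS.
      by apply: (@memv_scale_neq0 _ _ _ (k * k)); rewrite ?mulf_neq0 // sP ?inE ?eqxx ?orbT.
    have c2s : mul c c \in <<s>>%VS.
      by apply: (@memv_scale_neq0 _ _ _ (l * l)); rewrite ?mulf_neq0 // sP ?inE ?eqxx ?orbT.
    have s_ann : (ann mul <= <<s>>)%VS.
      apply: subv_trans ann_sub _; apply/span_subvP => z.
      by rewrite !inE => /orP[] /eqP->.
    apply: (frame_basis abc) => //.
    - by apply: sP; rewrite !inE eqxx ?orbT.
    - apply: (memv_scale_neq0 k0); rewrite -[k *: b](addrK u).
      by rewrite memvB ?(subvP s_ann u) //; apply: sP; rewrite !inE eqxx ?orbT.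
    - by apply: (memv_scale_neq0 l0); apply: sP; rewrite !inE eqxx ?orbT.
  case=> [[|[|[|[|[|//]]]]] jlt]; case=> [[|[|[|[|[|//]]]]] klt] // _;
    rewrite !(tnth_nth 0) /= ?(linearDl, linearDr) /= ?linearZl_LR ?linearZr_LR /=;
    by rewrite ?(ab, ba, ac, ca, bc, cb, u0, b2, c2) ?scaler0 ?addr0.
case=> [[|[|[|[|[|//]]]]] ilt]; rewrite !big_ord_recl big_ord0 !M221E /=;
  rewrite !(tnth_nth 0) /= ?scale0r ?scale1r ?addr0 ?add0r ?aE //.
- by rewrite addrAC.
- rewrite linearDl linearDr /= !u0 !addr0 linearZl_LR linearZr_LR /=.
  by rewrite scalerA.
- by rewrite linearZl_LR linearZr_LR /= scalerA.
- by rewrite linearZl_LR linearZr_LR /= b2 !scaler0.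
- by rewrite linearZl_LR linearZr_LR /= c2 !scaler0.
Qed.

(** A nonzero [k] would split E: a, k b + u, b^2 span one ideal, as a^2 = k b + u and (k b + u)^2 =
    k^2 b^2, while c, c^2 span a complementary one. *)
Lemma indecomposable_sqr_line a b c u (k : F) : frame a b c ->
  u \in ann mul -> mul b b \in ann mul -> mul c c \in ann mul ->
  mul a a = k *: b + u -> k = 0.
Proof.
move=> abc u_ann b2_ann c2_ann aE; apply/eqP/negPn/negP => k0; apply: indec.
have ann_sub : (ann mul <= <<[:: mul b b; mul c c]>>)%VS.
  apply: (@ann_sub_sqr_tail a b c u k 0) => //; rewrite ?k0 //.
  by rewrite scale0r addr0.
have [[u0 b2] c2] := (ann_mul u_ann, ann_mul b2_ann, ann_mul c2_ann).
have [[ab ba] [ac ca] [bc cb]] := frame_orth abc.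
pose s := [:: a; k *: b + u; mul b b] ++ [:: c; mul c c].
have s_full : <<s>>%VS = fullv.
  have sP z : z \in s -> z \in <<s>>%VS by apply: memv_span.
  have s_ann : (ann mul <= <<s>>)%VS.
    apply: subv_trans ann_sub _; apply/span_subvP => z.
    by rewrite !inE => /orP[] /eqP->; rewrite sP // !inE eqxx ?orbT.
  apply: (frame_span_full abc) => //.
  - by apply: sP; rewrite !inE eqxx ?orbT.
  - apply: (memv_scale_neq0 k0); rewrite -[k *: b](addrK u).
    by rewrite memvB ?(subvP s_ann u) //; apply: sP; rewrite !inE eqxx ?orbT.
  - by apply: sP; rewrite !inE eqxx ?orbT.
apply: (decomposable_cat s_full); rewrite ?dimE //.
- move=> y z; rewrite !inE => /or3P[] /eqP-> /or3P[] /eqP->;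
    rewrite ?(linearDl, linearDr) /= ?linearZl_LR ?linearZr_LR /=;
    rewrite ?(ab, ba, u0, b2) ?scaler0 ?addr0 ?mem0v // ?aE ?memvZ //;
    by rewrite memv_span // !inE eqxx ?orbT.
- move=> y z; rewrite !inE => /orP[] /eqP-> /orP[] /eqP->;
    rewrite ?c2 ?mem0v //;
    by apply: memv_span; rewrite !inE eqxx ?orbT.
- by move=> y z; rewrite !inE => /or3P[] /eqP-> /orP[] /eqP->;
    rewrite ?(linearDl, linearDr) /= ?linearZl_LR ?linearZr_LR /=;
    rewrite ?(ac, ca, bc, cb, u0, b2, c2) ?scaler0 ?addr0.
Qed.

(** With x^2 = k / l, the squares of [a] and x b have the same component along [c], so they differ
    by a vector [w] of the annihilator. The basis is a, x b, a^2, k^2 c^2, w. *)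
Lemma classified212 a b c u v (k l : F) : frame a b c ->
  u \in ann mul -> v \in ann mul -> mul c c \in ann mul ->
  mul a a = k *: c + u -> mul b b = l *: c + v -> k != 0 -> l != 0 -> classified.
Proof.
move=> abc u_ann v_ann c2_ann aE bE k0 l0.
have [x xx] := exists_sqrt (k / l).
have x0 : x != 0.
  apply: contraTneq isT => x0; move/eqP: xx.
  by rewrite x0 mul0r eq_sym mulf_eq0 invr_eq0 (negPf k0) (negPf l0).
(* This is (x b)^2 - a^2, kept opaque so that later simplification does not unfold it. *)
have [w wE] : {w | w = (x * x) *: v - u} by exists ((x * x) *: v - u).
have w_ann : w \in ann mul by rewrite wE memvB // memvZ.
have [[[u0 v0] c2] w0] := (ann_mul u_ann, ann_mul v_ann, ann_mul c2_ann, ann_mul w_ann).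
have [[ab ba] [ac ca] [bc cb]] := frame_orth abc.
(* A combination p a^2 + q b^2 + r c^2 lies in the annihilator only if its component p k + q l along
   [c] vanishes. Then q = -p x^2, and the first two terms reduce to -p w. *)
have ann_sub : (ann mul <= <<[:: mul c c; w]>>)%VS.
  apply/subvP => y yann.
  have /span3P[p [q [r yE]]] := subvP (frame_sqr abc) _ yann.
  have {}yE : y = (p * k + q * l) *: c + (p *: u + q *: v + r *: mul c c).
    by rewrite yE aE bE !scalerDr !scalerA scalerDl addrACA -[LHS]addrA.
  have : 0 *: a + 0 *: b + (p * k + q * l) *: c \in ann mul.
    rewrite !scale0r !add0r -[_ *: c](addrK (p *: u + q *: v + r *: mul c c)) -yE.
    by apply: memvB => //; do ![apply: memvD]; apply: memvZ.
  case/(frame_free abc) => _ _ pq; rewrite yE pq scale0r add0r.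
  have -> : q = - p * (x * x).
    by apply: (mulIf l0); rewrite xx -mulrA divfK // mulNr;
      apply/eqP; rewrite -addr_eq0 addrC pq.
  have -> : p *: u + (- p * (x * x)) *: v = - p *: w.
    by rewrite wE scalerBr scalerA scaleNr opprK addrC.
  by rewrite memvD // memvZ // memv_span // !inE eqxx ?orbT.
pose s := [tuple a; x *: b; k *: c + u; (k * k) *: mul c c; w].
have sP z : z \in tval s -> z \in <<s>>%VS by apply: memv_span.
exists ord_max; rewrite /model (tnth_nth 0) /=.
apply: (@alg_isomorphic_evo_mul _ _ _ _ s).
  split.
    have s_ann : (ann mul <= <<s>>)%VS.
      apply: subv_trans ann_sub _; apply/span_subvP => z.
      rewrite !inE => /orP[] /eqP->; last by apply: sP; rewrite !inE eqxx ?orbT.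
      by apply: (@memv_scale_neq0 _ _ _ (k * k)); rewrite ?mulf_neq0 // sP ?inE ?eqxx ?orbT.
    apply: (frame_basis abc) => //.
    - by apply: sP; rewrite !inE eqxx ?orbT.
    - by apply: (memv_scale_neq0 x0); apply: sP; rewrite !inE eqxx ?orbT.
    - apply: (memv_scale_neq0 k0); rewrite -[k *: c](addrK u).
      by rewrite memvB ?(subvP s_ann u) //; apply: sP; rewrite !inE eqxx ?orbT.
  case=> [[|[|[|[|[|//]]]]] jlt]; case=> [[|[|[|[|[|//]]]]] klt] // _;
    rewrite !(tnth_nth 0) /= ?(linearDl, linearDr) /= ?linearZl_LR ?linearZr_LR /=;
    by rewrite ?(ab, ba, ac, ca, bc, cb, u0, c2, w0) ?scaler0 ?addr0.
case=> [[|[|[|[|[|//]]]]] ilt]; rewrite !big_ord_recl big_ord0 !M212E /=;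
  rewrite !(tnth_nth 0) /= ?scale0r ?scale1r ?addr0 ?add0r ?aE //.
- rewrite linearZl_LR linearZr_LR /= bE scalerA scalerDr scalerA {1}xx divfK //.
  by rewrite wE -addrA [u + _]addrC subrK.
- rewrite linearDl linearDr /= !u0 !addr0 linearZl_LR linearZr_LR /=.
  by rewrite scalerA.
- by rewrite linearZl_LR linearZr_LR /= c2 !scaler0.
- by rewrite w0.
Qed.


(** The zero pattern of [k] and [l] decides: both zero leaves all squares in the annihilator, both
    nonzero gives type [2,2,1], and exactly one zero contradicts indecomposability. *)
Lemma classified_one_sqr a b c u (k l : F) : frame a b c ->
  u \in ann mul -> mul b b \in ann mul -> mul c c \in ann mul ->
  mul a a = k *: b + l *: c + u -> classified.
Proof.
move=> abc u_ann b2 c2 aE.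
have acb : frame a c b := frame_swap (frame_rot (frame_rot abc)).
have [k0 | k0] := eqVneq k 0.
  have l0 : l = 0.
    by apply: (indecomposable_sqr_line acb u_ann c2 b2); rewrite aE k0 scale0r add0r.
  by apply: (classified_sqr_ann abc) => //; rewrite aE k0 l0 !scale0r !add0r.
have [l0 | l0] := eqVneq l 0; last exact: (classified221 abc u_ann b2 c2 aE).
case/eqP: k0; apply: (indecomposable_sqr_line abc u_ann b2 c2).
by rewrite aE l0 scale0r addr0.
Qed.

Lemma classified_two_sqr a b c u v (k l : F) : frame a b c ->
  u \in ann mul -> v \in ann mul -> mul c c \in ann mul ->
  mul a a = k *: c + u -> mul b b = l *: c + v -> classified.
Proof.
move=> abc u_ann v_ann c2 aE bE.
have [k0 | k0] := eqVneq k 0.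
  apply: (@classified_one_sqr b c a v l 0 (frame_rot abc)) => //.
    by rewrite aE k0 scale0r add0r.
  by rewrite bE scale0r addr0.
have [l0 | l0] := eqVneq l 0; last exact: (classified212 abc u_ann v_ann c2 aE bE).
apply: (@classified_one_sqr a b c u 0 k abc) => //.
  by rewrite bE l0 scale0r add0r.
by rewrite aE scale0r add0r.
Qed.

(** * Squares modulo the annihilator and the case analysis *)

Lemma frame_cap_ann a b c : frame a b c -> (<<[:: a; b; c]>> :&: ann mul)%VS = 0%VS.
Proof.
move=> abc; apply/eqP; rewrite -subv0; apply/subvP => x /memv_capP[].
case/span3P=> k [l [m ->]] /(frame_free abc)[-> -> ->].
by rewrite !scale0r !addr0 mem0v.
Qed.

(* The span S of the squares contains the annihilator and has dimension at    *)
(* most 3, so S meets the span of a, b, c in at most a line.                  *)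
Lemma frame_sqr_mod_ann a b c : frame a b c ->
  exists x y z : F, forall s, s \in <<[:: mul a a; mul b b; mul c c]>>%VS ->
    exists p, exists2 u, u \in ann mul & s = p *: (x *: a + y *: b + z *: c) + u.
Proof.
move=> abc; set S := <<_>>%VS; set V : {vspace E} := <<[:: a; b; c]>>%VS.
(* [vpick] returns a nonzero vector, or 0 when the intersection is zero, so [q] generates the
   intersection in both cases. *)
pose q := vpick (V :&: S)%VS.
have VSq : (V :&: S <= <[q]>)%VS.
  have dimVS : (\dim (V :&: S) <= 1)%N.
    (* [V] meets the annihilator trivially, so dim (V :&: S) + 2 is the dimension of a subspace of
       [S], which is at most 3. *)
    rewrite -(leq_add2r (\dim (ann mul))) -dimv_disjoint_sum.
      apply: leq_trans (_ : \dim S <= _)%N; last by rewrite dim_annE dim_span.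
      by rewrite dimvS // subv_add capvSr (frame_sqr abc).
    apply/eqP; rewrite -subv0 -(frame_cap_ann abc) capvC [X in (_ <= X)%VS]capvC.
    by rewrite capvS ?capvSl.
  have [VS0 | VS0] := eqVneq (V :&: S)%VS 0%VS; first by rewrite VS0 sub0v.
  suff -> : <[q]>%VS = (V :&: S)%VS by [].
  by apply/eqP; rewrite eqEdim -memvE memv_pick dim_vline vpick0 VS0.
have /span3P[x [y [z qE]]] : q \in V by have /memv_capP[] := memv_pick (V :&: S)%VS.
exists x, y, z => s sS; rewrite -qE.
have : s \in (V + ann mul)%VS by rewrite (frame_span abc) memvf.
case/memv_addP=> v vV [u u_ann sE].
have : v \in (V :&: S)%VS.
  rewrite memv_cap vV -[v](addrK u) -sE.
  by rewrite memvB // (subvP (frame_sqr abc)).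
by case/(subvP VSq)/vlineP=> p vE; exists p; exists u; rewrite // -vE.
Qed.

(** Multiplying a^2 by [a] kills the terms in [b], [c], [u] and gives (a^2) a = k a^2. By nilpotency
    k = 0 or a^2 = 0, and in the second case independence modulo the annihilator gives k = 0. *)
Lemma frame_sqr_diag a b c (k l m : F) u : nilpotent mul -> frame a b c ->
  u \in ann mul -> mul a a = k *: a + l *: b + m *: c + u -> k = 0.
Proof.
move=> nil abc u_ann aE; have u0 := ann_mul u_ann.
have [[ab ba] [ac ca] [bc cb]] := frame_orth abc.
have : mul (mul a a) a = k *: mul a a.
  by rewrite {1}aE !linearDl /= !linearZl_LR /= ba ca u0 !scaler0 !addr0.
case/(nilpotent_mul_eigen nil) => // a2.
have : k *: a + l *: b + m *: c \in ann mul.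
  by rewrite -[_ + m *: c](addrK u) -aE a2 sub0r memvN.
by case/(frame_free abc).
Qed.

Lemma classified_frame a b c : nilpotent mul -> frame a b c -> classified.
Proof.
move=> nil abc; have [x [y [z sqrE]]] := frame_sqr_mod_ann abc.
have acb : frame a c b := frame_swap (frame_rot (frame_rot abc)).
have bca := frame_rot abc; have cab := frame_rot bca.
have [p [u u_ann]] : exists p, exists2 u, u \in ann mul &
    mul a a = p *: (x *: a + y *: b + z *: c) + u.
  by apply: sqrE; rewrite memv_span // !inE eqxx ?orbT.
have [q [v v_ann]] : exists p, exists2 u, u \in ann mul &
    mul b b = p *: (x *: a + y *: b + z *: c) + u.
  by apply: sqrE; rewrite memv_span // !inE eqxx ?orbT.
have [r [w w_ann]] : exists p, exists2 u, u \in ann mul &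
    mul c c = p *: (x *: a + y *: b + z *: c) + u.
  by apply: sqrE; rewrite memv_span // !inE eqxx ?orbT.
rewrite !scalerDr !scalerA => cE bE aE.
have px := frame_sqr_diag nil abc u_ann aE.
have qy : q * y = 0.
  by apply: (frame_sqr_diag nil bca v_ann);
  by rewrite bE -[_ + _ + (q * z) *: c]addrA [X in X + v]addrC.
have rz : r * z = 0.
  by apply: (frame_sqr_diag nil cab w_ann); rewrite cE [X in X + w]addrC addrA.
have {}aE : mul a a = (p * y) *: b + (p * z) *: c + u by rewrite aE px scale0r add0r.
have {}bE : mul b b = (q * x) *: a + (q * z) *: c + v by rewrite bE qy scale0r addr0.
have {}cE : mul c c = (r * x) *: a + (r * y) *: b + w by rewrite cE rz scale0r addr0.
have aE' : mul a a = (p * z) *: c + (p * y) *: b + u by rewrite aE [X in X + u]addrC.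
have bE' : mul b b = (q * z) *: c + (q * x) *: a + v by rewrite bE [X in X + v]addrC.
have a2 : p = 0 -> mul a a \in ann mul by move=> p0; rewrite aE p0 !mul0r !scale0r !add0r.
have b2 : q = 0 -> mul b b \in ann mul by move=> q0; rewrite bE q0 !mul0r !scale0r !add0r.
have c2 : r = 0 -> mul c c \in ann mul by move=> r0; rewrite cE r0 !mul0r !scale0r !add0r.
have cancel0 (k l : F) : k != 0 -> k * l = 0 -> l = 0.
  by move=> k0 /eqP; rewrite mulf_eq0 (negPf k0) => /eqP.
(* By px = qy = rz = 0, each nonzero one among p, q, r kills the coordinate of the common direction
   (x, y, z) at its own place, while a zero one puts its square in the annihilator. If all three are
   nonzero the direction itself is zero. *)
have [p0 | /cancel0/(_ px) x0] := eqVneq p 0;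
  have [q0 | /cancel0/(_ qy) y0] := eqVneq q 0;
  have [r0 | /cancel0/(_ rz) z0] := eqVneq r 0.
- by apply: (classified_sqr_ann abc); [apply: a2 | apply: b2 | apply: c2].
- exact: (classified_one_sqr cab w_ann (a2 p0) (b2 q0) cE).
- exact: (classified_one_sqr bca v_ann (c2 r0) (a2 p0) bE').
- apply: (classified_two_sqr bca v_ann w_ann (a2 p0)).
    by rewrite bE z0 mulr0 scale0r addr0.
  by rewrite cE y0 mulr0 scale0r addr0.
- exact: (classified_one_sqr abc u_ann (b2 q0) (c2 r0) aE).
- apply: (classified_two_sqr acb u_ann w_ann (b2 q0)).
    by rewrite aE z0 mulr0 scale0r addr0.
  by rewrite cE x0 mulr0 scale0r add0r.
- apply: (classified_two_sqr abc u_ann v_ann (c2 r0)).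
    by rewrite aE y0 mulr0 scale0r add0r.
  by rewrite bE x0 mulr0 scale0r add0r.
- apply: (classified_sqr_ann abc); rewrite ?aE ?bE ?cE ?x0 ?y0 ?z0;
    by rewrite !mulr0 !scale0r !add0r.
Qed.

End Frames.

(** * From a natural basis to a frame, and the conclusion *)

Lemma natural_basis_frame (F : closedFieldType) (E : vectType F)
    (mul : {bilinear E -> E -> E}) n (e : n.-tuple E) :
  is_natural_basis mul e -> (ann mul <= mulv mul fullv fullv)%VS ->
  \dim {:E} = (\dim (ann mul) + 3)%N -> exists a b c, frame mul a b c.
Proof.
move=> e_nat annE2 dimE.
have e_orth := natural_basis_orth e_nat.
have sqr_sub := sqr_sub_nonnull e_nat.
have perm_e := perm_null_nonnull mul e.
have free_e := basis_free e_nat.1.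
have span_null := span_null_basis e_nat.
have sub_e x : x \in nonnull_basis mul e -> x \in e by rewrite mem_filter => /andP[].
have := size_nonnull e_nat; rewrite dimE addnC => /addnI.
(* The basis vectors with zero square span the annihilator, so exactly dim E - dim ann(E) = 3 others
   remain. *)
case: (nonnull_basis mul e) perm_e sqr_sub sub_e => [|a [|b [|c []]]] //.
move=> perm_e sqr_sub sub_e _.
exists a, b, c.
have ea : a \in e by rewrite sub_e // !inE eqxx ?orbT.
have eb : b \in e by rewrite sub_e // !inE eqxx ?orbT.
have ec : c \in e by rewrite sub_e // !inE eqxx ?orbT.
move: free_e; rewrite -(perm_free perm_e) cat_free => /and3P[free_abc _ /directv_addP dir].
rewrite span_null in dir.
have [] := free_uniq free_abc; rewrite /= !inE negb_or => /and3P[/andP[ab ac] bc _].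
split.
- by rewrite -span_null -span_cat (eq_span (perm_mem perm_e)) (span_basis e_nat.1).
- move=> k l m klm.
  have : k *: a + l *: b + m *: c \in (<<[:: a; b; c]>> :&: ann mul)%VS.
    rewrite memv_cap klm andbT; do ![apply: memvD]; rewrite memvZ // memv_span //;
      by rewrite !inE eqxx ?orbT.
  rewrite dir memv0 => /eqP klm0.
  have /(_ (fun i : 'I_3 => [:: k; l; m]`_i))
    := elimT (@freeP _ _ _ [tuple a; b; c]) free_abc.
  rewrite !big_ord_recl big_ord0 /= addr0 addrA klm0 => /(_ erefl) k0.
  by have := (k0 ord0, k0 (inord 1), k0 (inord 2)); rewrite !inordK //= => -[[]].
- by split; rewrite !e_orth // eq_sym.
- exact: subv_trans annE2 sqr_sub.
Qed.

Theorem theorem6p1 (F : closedFieldType) (E : vectType F)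
    (mul : {bilinear E -> E -> E}) :
  2%N \notin [pchar F] ->
  is_evolution_algebra mul -> \dim {:E} = 5%N ->
  nilpotent mul -> indecomposable mul ->
  (\dim (ann mul) = 1%N \/ \dim (ann mul) = 2%N) /\
  (\dim (ann mul) = 2%N ->
     exists! i : 'I_3, alg_isomorphic mul (evo_mul (model F i))) /\
  [/\ has_type (evo_mul (M23 F)) [:: 2; 3]%N,
      has_type (evo_mul (M221 F)) [:: 2; 2; 1]%N &
      has_type (evo_mul (M212 F)) [:: 2; 1; 2]%N].
Proof.
move=> _ [n [e e_nat]] dimE nil indec.
have annE2 : (ann mul <= mulv mul fullv fullv)%VS.
  by apply: indecomposable_ann_sub_sqr; rewrite ?dimE.
split; last split; last exact: has_type_models.
  have : \dim (ann mul) != 0%N by rewrite dimv_eq0 nilpotent_ann_neq0 ?dimE.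
  have : (\dim (ann mul) <= size (nonnull_basis mul e))%N.
    apply: leq_trans (dimvS (subv_trans annE2 (sqr_sub_nonnull e_nat))) _.
    by rewrite (leq_trans (dim_span _)) ?size_map.
  (* Adding dim ann(E) to both sides gives 2 dim ann(E) <= 5, because the basis vectors with nonzero
     square number 5 - dim ann(E). *)
  rewrite -(leq_add2r (\dim (ann mul))) size_nonnull // dimE.
  by case: (\dim (ann mul)) => [|[|[|k]]] //; [left | right | rewrite !addnS].
move=> dim2; have [|a [b [c abc]]] := natural_basis_frame e_nat annE2.
  by rewrite dimE dim2.
have [i iso_i] := classified_frame dimE dim2 indec nil abc.
by exists i; split => // j; apply: alg_isomorphic_model_inj.
Qed.
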